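(* Let $\pi_\theta$ be a general autoregressive policy, let $r_{\mathrm{RM}} : \mathcal{X} \times \mathcal{Y} \to [-1,1]$ be a reward model, let $\lambda \ge 0$, let $\mathcal{S} \subseteq \mathcal{X}$ be the (finite, nonempty) set of training prompts, and let $\theta(t)$, $t \ge 0$, be the gradient flow trajectory maximizing the RLHF objective $\phi_{\mathrm{RLHF}}$ with respect to $r_{\mathrm{RM}}$ over $\mathcal{S}$, with $\theta(0) = \theta_{\mathrm{ref}}$. For any $\gamma > 0$, prompt $\mathbf{x} \in \mathcal{X}$, and reward function $r : \mathcal{X} \times \mathcal{Y} \to [-1,1]$, denote by $t_\gamma$ the initial (i.e. first) time $t\ge 0$ at which $$\mathbb{E}_{\mathbf{y} \sim \pi_{\theta(t)}(\cdot|\mathbf{x})}[r(\mathbf{x},\mathbf{y})] \ge \mathbb{E}_{\mathbf{y} \sim \pi_{\theta(0)}(\cdot|\mathbf{x})}[r(\mathbf{x},\mathbf{y})] + \gamma$$ (with $t_\gamma = \infty$ if no such time exists). Then, for any initial policy $\pi_{\theta(0)}$, $$t_\gamma \ge \frac{\min\left\{1 - \exp\left(-\frac{\gamma}{9}\right),\; 1 - \exp\left(-\frac{7}{3\lambda}\right)\right\}}{8 L^2 J_{t_\gamma}^2} \cdot \frac{1}{\left(\mathbb{E}_{\mathbf{x}' \sim \mathcal{S}}\left[\mathrm{Var}_{\mathbf{y} \sim \pi_{\theta(0)}(\cdot|\mathbf{x}')}[r_{\mathrm{RM}}(\mathbf{x}',\mathbf{y})]\right]\right)^{1/3}},$$ where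 $J_{t_\gamma} := \sup_{\mathbf{x}' \in \mathcal{X},\, \mathbf{y} \in \mathcal{Y},\, l \in \{1,\dots,L\},\, t \in [0,t_\gamma]} \| \mathbf{J}_{f_{\theta(t)}(\mathbf{x}',\mathbf{y}_{<l})} \|_2$.
   Context: Setting. $\mathcal{V}$ is a finite vocabulary of tokens, $\mathcal{V}^*$ is the set of finite token sequences, $\mathcal{X} \subseteq \mathcal{V}^*$ is the set of prompts, and $\mathcal{Y} = \mathcal{V}^L$ is the set of outputs (sequences of length $L \in \mathbb{N}$). For $\mathbf{y}\in\mathcal{Y}$, $\mathbf{y}_l$ is its $l$th token and $\mathbf{y}_{<l}$ its first $l-1$ tokens. $\mathrm{softmax}(\mathbf{z})_v := \exp(\mathbf{z}_v)/\sum_{v' \in \mathcal{V}} \exp(\mathbf{z}_{v'})$ for $\mathbf{z} \in \mathbb{R}^{|\mathcal{V}|}$. General autoregressive policy: $\pi_\theta(\mathbf{y}|\mathbf{x}) = \prod_{l=1}^{|\mathbf{y}|} \pi_\theta(\mathbf{y}_l | \mathbf{x}, \mathbf{y}_{<l}) = \prod_{l=1}^{|\mathbf{y}|} \mathrm{softmax}(f_\theta(\mathbf{x},\mathbf{y}_{<l}))_{\mathbf{y}_l}$, where $f_\theta : \mathcal{V}^* \to \mathbb{R}^{|\mathcal{V}|}$ is differentiable with respect to its (finite-dimensional real) parameters $\theta$. $\mathbf{J}_{f_\theta(\mathbf{x},\mathbf{y}_{<l})}$ denotes the Jacobian of $f_\theta(\mathbf{x},\mathbf{y}_{<l})$ with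 respect to $\theta$, and $\|\cdot\|_2$ is the spectral norm. RLHF objective with KL coefficient $\lambda \ge 0$: $$\phi_{\mathrm{RLHF}}(\theta) := \mathbb{E}_{\mathbf{x} \sim \mathcal{S}}\Big[\mathbb{E}_{\mathbf{y} \sim \pi_\theta(\cdot|\mathbf{x})}[r_{\mathrm{RM}}(\mathbf{x},\mathbf{y})] - \lambda \cdot \mathrm{KL}\big(\pi_\theta(\cdot|\mathbf{x}) \,\|\, \pi_{\theta_{\mathrm{ref}}}(\cdot|\mathbf{x})\big)\Big],$$ where $\mathbf{x} \sim \mathcal{S}$ is uniform on $\mathcal{S}$ and $\mathrm{KL}(p\|q)=\sum_{\mathbf{y}} p(\mathbf{y}) \ln (p(\mathbf{y})/q(\mathbf{y}))$. Gradient flow: $\frac{d}{dt}\theta(t) = \nabla \phi_{\mathrm{RLHF}}(\theta(t))$ for $t \ge 0$, with $\theta(0) = \theta_{\mathrm{ref}}$; the trajectory is taken to exist for all $t\ge 0$. Conventions: $\exp(-\frac{7}{3\lambda}) = 0$ if $\lambda = 0$; the lower bound is read as $+\infty$ if the averaged reward variance or $J_{t_\gamma}$ is $0$, and otherwise as $0$ if $J_{t_\gamma} = \infty$. *)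

(* Defs.v *)
From HB Require Import structures.
From mathcomp Require Import all_boot all_order all_algebra finmap.
From mathcomp Require Import all_classical all_reals all_analysis.

Set Implicit Arguments.
Unset Strict Implicit.
Unset Printing Implicit Defensive.

Import Order.TTheory GRing.Theory Num.Theory.
Import numFieldNormedType.Exports.

Local Open Scope classical_set_scope.
Local Open Scope ring_scope.

(* A vector of R^|V| is a row vector; the coordinate of the token v is the one
   at index [enum_rank v]. *)
Definition softmax (R : realType) (V : finType) (z : 'rV[R]_#|V|) (v : V) : R :=
  expR (z 0 (enum_rank v)) / \sum_(w : V) expR (z 0 (enum_rank w)).

(* Positions are counted from 0, so for l : 'I_L the prefix preceding the token
   [tnth y l] is [take l y], and the token sequence (x, y_{<l}) is the
   concatenation [x ++ take l y]. *)
Definition policy (R : realType) (V : finType) (L p : nat)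
    (f : 'rV[R]_p -> seq V -> 'rV[R]_#|V|) (theta : 'rV[R]_p)
    (x : seq V) (y : L.-tuple V) : R :=
  \prod_(l < L) softmax (f theta (x ++ take l y)) (tnth y l).

Definition fin_expectation (R : realType) (Y : finType) (P g : Y -> R) : R :=
  \sum_(y : Y) P y * g y.

Definition fin_variance (R : realType) (Y : finType) (P g : Y -> R) : R :=
  fin_expectation P (fun y => (g y - fin_expectation P g) ^+ 2).

Definition KL (R : realType) (Y : finType) (P Q : Y -> R) : R :=
  \sum_(y : Y) P y * ln (P y / Q y).

Definition uniform_mean (R : realType) (T : choiceType) (S : {fset T})
    (g : T -> R) : R :=
  (\sum_(x <- S) g x) / #|` S|%:R.

Definition phi_RLHF (R : realType) (V : finType) (L p : nat)
    (f : 'rV[R]_p -> seq V -> 'rV[R]_#|V|) (rRM : seq V -> L.-tuple V -> R)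
    (lambda : R) (S : {fset (seq V)}) (theta_ref theta : 'rV[R]_p) : R :=
  uniform_mean S (fun x =>
    fin_expectation (policy f theta x) (rRM x) -
    lambda * KL (policy (L := L) f theta x) (policy f theta_ref x)).

Definition gradient (R : realType) (p : nat) (phi : 'rV[R]_p -> R)
    (theta : 'rV[R]_p) : 'rV[R]_p :=
  \row_(i < p) 'D_(delta_mx 0 i) phi theta.

(* [theta] is only constrained on [0, +oo); the derivative at time 0 is the
   right derivative. *)
Definition gradient_flow (R : realType) (p : nat) (phi : 'rV[R]_p -> R)
    (theta0 : 'rV[R]_p) (theta : R -> 'rV[R]_p) : Prop :=
  [/\ theta 0 = theta0,
      h^-1 *: (theta h - theta 0) @[h --> 0^'+] --> gradient phi (theta 0)
    & forall t : R, 0 < t -> is_derive t 1 theta (gradient phi (theta t))].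

Definition norm2 (R : realType) (n : nat) (v : 'rV[R]_n) : R :=
  Num.sqrt (\sum_(i < n) v 0 i ^+ 2).

(* Operator norm of v |-> v *m A for the Euclidean norms.  The Jacobian 'J f a
   acts on row vectors ('D_v f a = v *m 'J f a), so this is the spectral norm
   of the usual (transposed) Jacobian matrix. *)
Definition spectral_norm (R : realType) (m n : nat) (A : 'M[R]_(m, n)) : R :=
  sup [set norm2 (v *m A) | v in [set v : 'rV[R]_m | norm2 v <= 1]].

(* First time at which the expected reward has increased by gamma.  The set of
   such times is closed when the trajectory is continuous, so that the infimum
   is attained if it is finite; it is +oo if there is no such time. *)
Definition hitting_time (R : realType) (V : finType) (L p : nat)
    (f : 'rV[R]_p -> seq V -> 'rV[R]_#|V|) (theta : R -> 'rV[R]_p)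
    (x : seq V) (r : seq V -> L.-tuple V -> R) (gamma : R) : \bar R :=
  ereal_inf [set t%:E | t in [set t : R | 0 <= t /\
    fin_expectation (policy f (theta 0) x) (r x) + gamma <=
    fin_expectation (policy f (theta t) x) (r x)]].

Lemma hitting_time_first (R : realType) (V : finType) (L p : nat)
    (f : 'rV[R]_p -> seq V -> 'rV[R]_#|V|) (theta : R -> 'rV[R]_p)
    (x : seq V) (r : seq V -> L.-tuple V -> R) (gamma t : R) :
  let reached s := 0 <= s /\
    fin_expectation (policy f (theta 0) x) (r x) + gamma <=
    fin_expectation (policy f (theta s) x) (r x) in
  reached t -> (forall s : R, reached s -> t <= s) ->
  hitting_time f theta x r gamma = t%:E.
Proof.
move=> reached rt tmin; apply/eqP; rewrite eq_le; apply/andP; split.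
  by apply: ereal_inf_lbound; exists t.
by apply: le_ereal_inf_tmp => _ [s rs <-]; rewrite lee_fin; apply: tmin.
Qed.

Lemma hitting_time_never (R : realType) (V : finType) (L p : nat)
    (f : 'rV[R]_p -> seq V -> 'rV[R]_#|V|) (theta : R -> 'rV[R]_p)
    (x : seq V) (r : seq V -> L.-tuple V -> R) (gamma : R) :
  (forall t : R, 0 <= t ->
    fin_expectation (policy f (theta t) x) (r x) <
    fin_expectation (policy f (theta 0) x) (r x) + gamma) ->
  hitting_time f theta x r gamma = +oo%E.
Proof.
move=> H; rewrite /hitting_time [X in image X _](_ : _ = set0).
  by rewrite image_set0 ereal_inf0.
by apply/seteqP; split=> // t [t0]; rewrite leNgt H.
Qed.

(* The logits that matter have arguments (x, y_{<l}) with x in X, y of length L;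
   T is the final time, possibly +oo. *)
Definition jacobian_sup (R : realType) (V : finType) (L p : nat)
    (X : set (seq V)) (f : 'rV[R]_p -> seq V -> 'rV[R]_#|V|)
    (theta : R -> 'rV[R]_p) (T : \bar R) : \bar R :=
  ereal_sup [set z | exists (x : seq V) (y : L.-tuple V) (l : 'I_L) (t : R),
    [/\ X x, 0 <= t, (t%:E <= T)%E &
        z = (spectral_norm
               ('J (fun th => f th (x ++ take l y)) (theta t)))%:E]].

(* Here exp(- 7 / (3 lambda)) is read as 0 if lambda = 0. *)
Definition exp_KL (R : realType) (lambda : R) : R :=
  if lambda == 0 then 0 else expR (- (7 / (3 * lambda))).

(* v is the average reward variance and J the supremum of the Jacobian norms.
   The value is +oo if v or J is 0, and otherwise 0 if J is +oo. *)
Definition time_lower_bound (R : realType) (L : nat) (gamma lambda v : R)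
    (J : \bar R) : \bar R :=
  if (v == 0) || (J == 0%E) then +oo%E
  else if J == +oo%E then 0%E
  else (Num.min (1 - expR (- (gamma / 9))) (1 - exp_KL lambda) /
          (8 * L%:R ^+ 2 * fine J ^+ 2) *
        (1 / v `^ (1 / 3)))%:E.

(* Main.v *)
(** Write [pi] for the policy, [s_y] for the time derivative of [ln pi(y | x)] along
the flow, [g = r_RM - lambda ln (pi / pi_ref)], and [u] for the average over the
training prompts of the variance of [g].  The gradient of the objective is the
average of [E (g - E g) grad (ln pi)], and every logit moves at speed at most
[J |theta'|], so [|s_y| <= 2 L J |grad phi|].  By Cauchy-Schwarz
[|grad phi| <= 2 L J sqrt u], hence expected rewards grow at rate at most
[4 a sqrt u], with [a = L^2 J^2].  In the derivative of [u], the part that comes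
from the dependence of [g] on [theta] is exactly [-2 lambda |grad phi|^2 <= 0];
therefore [u' <= 4 a u^(3/2)], whatever [lambda] is.  So [u] stays of the order of
its initial value [v] up to times of order [1 / (a sqrt v)], which gives a lower
bound [gamma / (72 a sqrt v)] on the hitting time; the stated bound is weaker
because [v <= 1]. *)
Require Import Defs.
From mathcomp Require Import all_boot all_order all_algebra finmap.
From mathcomp Require Import all_classical all_reals all_analysis.
From mathcomp Require Import ring lra.
Import Order.TTheory GRing.Theory Num.Theory.
Import numFieldNormedType.Exports.
Local Open Scope classical_set_scope.
Local Open Scope ring_scope.

Set Implicit Arguments.
Unset Strict Implicit.
Unset Printing Implicit Defensive.

(** * Derivatives of finite sums and products *)

Lemma is_derive_bigsum (R : realType) (I : Type) (r : seq I)
    (h : I -> R -> R) (dh : I -> R) (t : R) :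
  (forall i, is_derive t 1 (h i) (dh i)) ->
  is_derive t 1 (fun u => \sum_(i <- r) h i u) (\sum_(i <- r) dh i).
Proof.
move=> hP; elim: r => [|i r IHr].
  rewrite big_nil; have -> : (fun u => \sum_(i <- [::]) h i u) = cst 0.
    by apply/funext => u; rewrite big_nil.
  exact: is_derive_cst.
have -> : (fun u => \sum_(j <- i :: r) h j u) =
    h i + (fun u => \sum_(j <- r) h j u).
  by apply/funext => u; rewrite big_cons.
by rewrite big_cons; apply: is_deriveD.
Qed.

Lemma is_derive_mul (R : realType) (f g : R -> R) (t a b : R) :
  is_derive t 1 f a -> is_derive t 1 g b ->
  is_derive t 1 (fun u => f u * g u) (a * g t + f t * b).
Proof.
move=> fa gb; apply: is_derive_eq (is_deriveM fa gb) _.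
by rewrite addrC; congr (_ + _); rewrite mulrC.
Qed.

(** * Expectation and variance along a curve of finite distributions *)

Section FiniteFamily.
Context {R : realType} {Y : finType}.
Implicit Types (P g : Y -> R).

Lemma fin_varianceE P g : \sum_y P y = 1 ->
  fin_variance P g = fin_expectation P (fun y => g y ^+ 2)
                     - fin_expectation P g ^+ 2.
Proof.
move=> P1; rewrite /fin_variance; set m := fin_expectation P g.
rewrite /fin_expectation.
rewrite (eq_bigr (fun y =>
  P y * g y ^+ 2 - (2 * m) * (P y * g y) + m ^+ 2 * P y)); last by
  move=> y _; ring.
rewrite big_split /= big_split /= sumrN -!mulr_sumr P1.
by rewrite -/(fin_expectation P g) -/m; ring.
Qed.

Lemma fin_variance_ge0 P g : (forall y, 0 <= P y) -> 0 <= fin_variance P g.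
Proof.
by move=> P0; apply: sumr_ge0 => y _; rewrite mulr_ge0 ?sqr_ge0.
Qed.

Lemma fin_variance_eq0 P g : (forall y, 0 < P y) -> fin_variance P g = 0 ->
  forall y, g y = fin_expectation P g.
Proof.
move=> P0 V0 y; apply/eqP; rewrite -subr_eq0 -sqrf_eq0.
have h0 z : true -> 0 <= P z * (g z - fin_expectation P g) ^+ 2.
  by rewrite mulr_ge0 ?sqr_ge0 // ltW.
have /eqP : P y * (g y - fin_expectation P g) ^+ 2 = 0.
  exact: psumr_eq0P h0 V0 y isT.
by rewrite mulf_eq0 gt_eqF.
Qed.

Lemma fin_variance_le1 P g : (forall y, 0 <= P y) -> \sum_y P y = 1 ->
  (forall y, -1 <= g y <= 1) -> fin_variance P g <= 1.
Proof.
move=> P0 P1 gb; rewrite fin_varianceE// lerBlDr.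
apply: (@le_trans _ _ (\sum_y P y)); last by rewrite P1 lerDl sqr_ge0.
apply: ler_sum => y _; rewrite ler_piMr // expr2.
by have := gb y; nra.
Qed.

Lemma fin_expectation_itv P g : (forall y, 0 <= P y) -> \sum_y P y = 1 ->
  (forall y, -1 <= g y <= 1) -> -1 <= fin_expectation P g <= 1.
Proof.
move=> P0 P1 gb; rewrite -P1 -sumrN; apply/andP; split; apply: ler_sum => y _;
  have := gb y; have := P0 y; nra.
Qed.

(** Termwise, [ln z <= z - 1] at [z = Q y / P y] gives [P y - Q y <= P y * ln (P y / Q y)], and the
    left-hand sides sum to 0. *)
Lemma KL_ge0 P Q : (forall y, 0 < P y) -> (forall y, 0 < Q y) ->
  \sum_y P y = 1 -> \sum_y Q y = 1 -> 0 <= KL P Q.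
Proof.
move=> P0 Q0 P1 Q1; rewrite -(subrr 1) -[X in X - _]P1 -Q1 -sumrB.
apply: ler_sum => y _.
have := le_ln1Dx (x := Q y / P y - 1); rewrite addrCA subrr addr0.
rewrite ltrBrDl subrr divr_gt0// => /(_ isT).
rewrite -(invf_div (P y)) lnV ?posrE ?divr_gt0// => h.
have -> : P y - Q y = P y * - ((P y / Q y)^-1 - 1).
  by rewrite invf_div; field; rewrite gt_eqF.
by rewrite ler_pM2l //; lra.
Qed.

Lemma sum_mul_le_expectation (B : R) P (a b : Y -> R) : (forall y, 0 <= P y) ->
  (forall y, `|a y| <= B) ->
  \sum_y P y * a y * b y <= B * fin_expectation P (fun y => `|b y|).
Proof.
move=> P0 aB; rewrite /fin_expectation mulr_sumr; apply: ler_sum => y _.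
rewrite -mulrA [leRHS]mulrCA ler_wpM2l //.
by rewrite (le_trans (ler_norm _))// normrM ler_wpM2r.
Qed.

Section Derivatives.
Variables (P : R -> Y -> R) (t : R) (s : Y -> R).
Hypothesis P1 : forall u, \sum_y P u y = 1.
Hypothesis dP : forall y, is_derive t 1 (fun u => P u y) (P t y * s y).

(** [s] is the logarithmic derivative of [P]; its mean vanishes because the total mass stays 1. *)
Lemma sum_score : \sum_y P t y * s y = 0.
Proof.
have [_ <-] := is_derive_bigsum (index_enum Y) dP.
have -> : (fun u => \sum_y P u y) = cst 1 by apply/funext => u; rewrite P1.
by rewrite derive_val.
Qed.

Lemma is_derive_expectation (g : R -> Y -> R) (dg : Y -> R) :
  (forall y, is_derive t 1 (fun u => g u y) (dg y)) ->
  is_derive t 1 (fun u => fin_expectation (P u) (g u))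
    (\sum_y P t y * (s y * g t y + dg y)).
Proof.
move=> gdg; apply: is_derive_bigsum => y.
apply: is_derive_eq (is_derive_mul (dP y) (gdg y)) _.
by rewrite mulrDr mulrA.
Qed.

Lemma is_derive_expectation_cst g :
  is_derive t 1 (fun u => fin_expectation (P u) g) (\sum_y P t y * s y * g y).
Proof.
apply: is_derive_eq (@is_derive_expectation (fun=> g) (fun=> 0) _) _.
  by move=> y; exact: is_derive_cst.
by apply: eq_bigr => y _; rewrite addr0 mulrA.
Qed.

Variables (g : R -> Y -> R) (lam : R).
Hypothesis dg : forall y, is_derive t 1 (fun u => g u y) (- lam * s y).

(** The explicit time dependence of [g] contributes [- lam] times the mean of [s], which is 0. *)
Lemma is_derive_expectation_score :
  is_derive t 1 (fun u => fin_expectation (P u) (g u))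
    (\sum_y P t y * s y * g t y).
Proof.
apply: is_derive_eq (is_derive_expectation dg) _.
rewrite (eq_bigr (fun y => P t y * s y * g t y - lam * (P t y * s y)));
  last by move=> y _; ring.
by rewrite sumrB -mulr_sumr sum_score mulr0 subr0.
Qed.

(** Differentiate the mean of [g ^+ 2] minus the squared mean of [g], and drop the multiples of the
    mean of [s]. The last sum is the rate of change of the mean of [g]; averaged over the prompts
    along the flow it becomes the squared gradient norm, so its term damps the variance when
    [lam >= 0]. *)
Lemma is_derive_variance :
  is_derive t 1 (fun u => fin_variance (P u) (g u))
    (\sum_y P t y * s y * (g t y - fin_expectation (P t) (g t)) ^+ 2
     - 2 * lam * \sum_y P t y * s y * g t y).
Proof.
have -> : (fun u => fin_variance (P u) (g u)) =
    (fun u => fin_expectation (P u) (fun y => g u y * g u y) +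
       -1 * (fin_expectation (P u) (g u) * fin_expectation (P u) (g u))).
  by apply/funext => u; rewrite fin_varianceE// mulN1r.
set m := fin_expectation _ _.
have d1 := is_derive_expectation
  (fun y => is_derive_mul (dg y) (dg y)).
have d2 := is_derive_expectation_score.
have d3 := is_deriveD d1 (is_deriveZ (-1) (is_derive_mul d2 d2)).
apply: is_derive_eq d3 _.
rewrite -/m (eq_bigr (fun y => P t y * s y * (g t y - m) ^+ 2
  - (2 * lam) * (P t y * s y * g t y) + (2 * m) * (P t y * s y * g t y)
  - m ^+ 2 * (P t y * s y))); last by move=> y _; ring.
rewrite !(big_split, sumrN) /= -!mulr_sumr sum_score.
by rewrite /GRing.scale /=; ring.
Qed.

End Derivatives.
End FiniteFamily.

(** * Autoregressive policies *)

(** Induction on the length: once the first token [v] is split off, the remaining ones follow the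
    kernel [fun s => q (v :: s)]. *)
Lemma autoregressive_sum1 (R : realType) (V : finType) (L : nat)
    (q : seq V -> V -> R) :
  (forall s, \sum_v q s v = 1) ->
  \sum_(y : L.-tuple V) \prod_(l < L) q (take l y) (tnth y l) = 1.
Proof.
elim: L q => [|L IHL] q q1.
  rewrite (big_pred1 [tuple]); first by rewrite big_ord0.
  by move=> y /=; rewrite tuple0; apply/esym/eqP.
pose join (p : V * L.-tuple V) := [tuple of p.1 :: p.2].
rewrite (reindex join) /=; last first.
  exists (fun y => (thead y, [tuple of behead y])) => [[v y]|y] _.
    by rewrite /join theadE; congr pair; apply/val_inj.
  by rewrite /join -tuple_eta.
rewrite -(pair_bigA _ (fun v y => \prod_(l < L.+1)
  q (take l (join (v, y))) (tnth (join (v, y)) l))) /= -[RHS](q1 [::]).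
apply: eq_bigr => v _.
under eq_bigr => y _ do rewrite big_ord_recl tnth0 take0 [(v, y).1]/=.
rewrite -mulr_sumr -[RHS]mulr1; congr (_ * _).
rewrite -[RHS](IHL (fun s => q (v :: s))); last by move=> s; exact: q1.
by apply: eq_bigr => y _; apply: eq_bigr => l _; rewrite tnthS.
Qed.

Lemma sum_expR_gt0 (R : realType) (V : finType) (z : V -> R) (v : V) :
  0 < \sum_w expR (z w).
Proof.
by rewrite (bigD1 v) //= ltr_pwDl ?expR_gt0// sumr_ge0 // => w _; apply: expR_ge0.
Qed.

(** The token [v0] witnesses that the vocabulary is nonempty; over an empty one the sum would be
    0. *)
Lemma sum_softmax (R : realType) (V : finType) (z : 'rV[R]_#|V|) (v0 : V) :
  \sum_v softmax z v = 1.
Proof. by rewrite -mulr_suml divff // gt_eqF // (sum_expR_gt0 _ v0). Qed.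

Lemma softmax_gt0 (R : realType) (V : finType) (z : 'rV[R]_#|V|) (v : V) :
  0 < softmax z v.
Proof. by rewrite divr_gt0 ?expR_gt0 // (sum_expR_gt0 _ v). Qed.

(** A directional derivative at [a] is a derivative at time 0 along this curve, so one chain rule
    along curves serves both the gradient and the flow. *)
Definition line (R : realType) (p : nat) (a h : 'rV[R]_p) (u : R) : 'rV[R]_p :=
  u *: h + a.

Lemma line0 (R : realType) (p : nat) (a h : 'rV[R]_p) : line a h 0 = a.
Proof. by rewrite /line scale0r add0r. Qed.

Lemma is_derive_line (R : realType) (p : nat) (a h : 'rV[R]_p) (t : R) :
  is_derive t 1 (line a h) h.
Proof.
have dh : is_derive t 1 ( *:%R^~ h) h.
  apply: DeriveDef; first exact/diff_derivable.
  by rewrite deriveE // diff_val scale1r.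
by apply: is_derive_eq (is_deriveD dh (is_derive_cst a t 1)) _; rewrite addr0.
Qed.

Section Policy.
Context {R : realType} {V : finType} {L p : nat}.
Variable f : 'rV[R]_p -> seq V -> 'rV[R]_#|V|.
Implicit Types (th h : 'rV[R]_p) (x : seq V) (y : L.-tuple V).

Definition log_policy th x y : R :=
  \sum_(l < L) (f th (x ++ take l y) 0 (enum_rank (tnth y l)) -
    ln (\sum_w expR (f th (x ++ take l y) 0 (enum_rank w)))).

Lemma policyE th x y : policy f th x y = expR (log_policy th x y).
Proof.
rewrite /policy /log_policy expR_sum; apply: eq_bigr => l _.
by rewrite expRB lnK // posrE (sum_expR_gt0 _ (tnth y l)).
Qed.

Lemma policy_gt0 th x y : 0 < policy f th x y.
Proof. by rewrite policyE expR_gt0. Qed.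

Lemma sum_policy th x (v0 : V) : \sum_(y : L.-tuple V) policy f th x y = 1.
Proof.
exact: (autoregressive_sum1 L (q := fun s => softmax (f th (x ++ s))))
  (fun s => sum_softmax _ v0).
Qed.

Definition logit_deriv th h (s : seq V) (w : V) : R :=
  (h *m 'J (f^~ s) th) 0 (enum_rank w).

(* The directional derivative of [log_policy] at [th] along [h]. *)
Definition score th h x y : R :=
  \sum_(l < L) (logit_deriv th h (x ++ take l y) (tnth y l) -
    \sum_w softmax (f th (x ++ take l y)) w *
      logit_deriv th h (x ++ take l y) w).

(** The Jacobian acts linearly on the direction. This recombines the coordinate derivatives of the
    gradient into a derivative along any [h]. *)
Lemma score_sum th h x y :
  score th h x y = \sum_(i < p) h 0 i * score th (delta_mx 0 i) x y.
Proof.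
have lin s w : logit_deriv th h s w =
    \sum_(i < p) h 0 i * logit_deriv th (delta_mx 0 i) s w.
  rewrite /logit_deriv {1}(row_sum_delta h) mulmx_suml summxE.
  by apply: eq_bigr => i _; rewrite -scalemxAl mxE.
rewrite /score; under [RHS]eq_bigr => i _ do rewrite mulr_sumr.
rewrite exchange_big /=; apply: eq_bigr => l _.
rewrite [in RHS](eq_bigr (fun i => h 0 i *
    logit_deriv th (delta_mx 0 i) (x ++ take l y) (tnth y l) -
  h 0 i * \sum_w softmax (f th (x ++ take l y)) w *
    logit_deriv th (delta_mx 0 i) (x ++ take l y) w)); last first.
  by move=> i _; rewrite mulrBr.
rewrite sumrB -lin; congr (_ - _).
under [RHS]eq_bigr => i _ do rewrite mulr_sumr.
rewrite exchange_big /=; apply: eq_bigr => w _.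
by rewrite lin mulr_sumr; apply: eq_bigr => i _; rewrite mulrCA.
Qed.

(** Each of the [L] positions contributes a logit derivative minus a softmax average of logit
    derivatives, both at most [B] in absolute value. *)
Lemma normr_score th h x y (B : R) :
  (forall (l : 'I_L) w, `|logit_deriv th h (x ++ take l y) w| <= B) ->
  `|score th h x y| <= 2 * L%:R * B.
Proof.
move=> dB; rewrite (le_trans (ler_norm_sum _ _ _)) //.
apply: (@le_trans _ _ (\sum_(l < L) 2 * B)); last first.
  by rewrite sumr_const card_ord -mulr_natr; lra.
apply: ler_sum => l _; rewrite (le_trans (ler_normB _ _)) //.
rewrite mulr_natl mulr2n lerD // (le_trans (ler_norm_sum _ _ _)) //.
rewrite -[leRHS]mul1r -(sum_softmax (f th (x ++ take l y)) (tnth y l)).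
rewrite mulr_suml; apply: ler_sum => w _.
by rewrite normrM gtr0_norm ?softmax_gt0 // ler_wpM2l // ltW ?softmax_gt0.
Qed.

Hypothesis f_diff : forall (s : seq V) th, differentiable (f^~ s) th.

Section Curve.
Variables (c : R -> 'rV[R]_p) (t : R) (h : 'rV[R]_p).
Hypothesis c_h : is_derive t 1 c h.

Lemma is_derive_logit s w :
  is_derive t 1 (fun u => f (c u) s 0 (enum_rank w)) (logit_deriv (c t) h s w).
Proof.
have [/derivable1_diffP dc ch] := c_h.
have dfc : differentiable (f^~ s \o c) t by exact: differentiable_comp.
have Dfc : 'D_1 (f^~ s \o c) t = h *m 'J (f^~ s) (c t).
  rewrite deriveE // diff_comp //= -ch deriveE //.
  by rewrite -(deriveE _ (f_diff s (c t))) deriveEjacobian.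
have /derivable1_diffP dfc1 := dfc.
have /derivable_mxP dM := dfc1.
apply: DeriveDef; first exact: dM.
by rewrite /logit_deriv -Dfc derive_mx // mxE.
Qed.

Lemma is_derive_log_policy x y :
  is_derive t 1 (fun u => log_policy (c u) x y) (score (c t) h x y).
Proof.
apply: is_derive_bigsum => l; set s := x ++ take l y.
apply: is_deriveB (is_derive_logit s (tnth y l)) _.
have dsum : is_derive t 1 (fun u => \sum_w expR (f (c u) s 0 (enum_rank w)))
    (\sum_w expR (f (c t) s 0 (enum_rank w)) * logit_deriv (c t) h s w).
  apply: is_derive_bigsum => w.
  exact: is_derive1_comp (is_derive_expR _) (is_derive_logit s w).
apply: is_derive_eq (is_derive1_comp
  (is_derive1_ln (sum_expR_gt0 _ (tnth y l))) dsum) _.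
rewrite mulr_sumr; apply: eq_bigr => w _; rewrite /softmax mulrA.
by congr (_ * _); rewrite mulrC.
Qed.

Lemma is_derive_policy x y :
  is_derive t 1 (fun u => policy f (c u) x y)
    (policy f (c t) x y * score (c t) h x y).
Proof.
have -> : (fun u => policy f (c u) x y) = expR \o (fun u => log_policy (c u) x y).
  by apply/funext => u /=; rewrite policyE.
rewrite policyE.
exact: is_derive1_comp (is_derive_expR _) (is_derive_log_policy x y).
Qed.

End Curve.

Lemma sum_policy_score (v0 : V) th h x :
  \sum_(y : L.-tuple V) policy f th x y * score th h x y = 0.
Proof.
rewrite -(line0 th h).
exact: (sum_score (fun u => sum_policy (line th h u) x v0)
  (is_derive_policy (is_derive_line th h 0) x)).
Qed.

Variables (rRM : seq V -> L.-tuple V -> R) (lambda : R) (theta_ref : 'rV[R]_p).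
Variable S : {fset (seq V)}.

(** The objective is the mean over the prompts of the expectation of this reward, whose penalty
    vanishes at [theta_ref]. Along a curve its derivative is [- lambda] times the score, the form
    assumed by the derivative formulas for expectation and variance. *)
Definition KL_reward th x y : R :=
  rRM x y - lambda * (log_policy th x y - log_policy theta_ref x y).

Lemma KL_policy th x : KL (policy (L := L) f th x) (policy f theta_ref x) =
  fin_expectation (policy f th x)
    (fun y => log_policy th x y - log_policy theta_ref x y).
Proof. by apply: eq_bigr => y _; rewrite !policyE -expRB expRK. Qed.

Lemma phi_RLHFE : phi_RLHF f rRM lambda S theta_ref = fun th =>
  uniform_mean S (fun x => fin_expectation (policy f th x) (KL_reward th x)).
Proof.
apply/funext => th; congr (_ / _); apply: eq_bigr => x _.
rewrite KL_policy /fin_expectation mulr_sumr -sumrB; apply: eq_bigr => y _.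
by rewrite /KL_reward; ring.
Qed.

Lemma is_derive_uniform_mean (F : seq V -> R -> R) (dF : seq V -> R) (t : R) :
  (forall x, is_derive t 1 (F x) (dF x)) ->
  is_derive t 1 (fun u => uniform_mean S (F^~ u)) (uniform_mean S dF).
Proof.
move=> FdF; have FF := is_derive_bigsum (enum_fset S) FdF.
have := is_derive_mul FF (is_derive_cst (#|` S|%:R^-1 : R) t 1).
by rewrite mulr0 addr0.
Qed.

(** Policy gradient formula: the dependence of [KL_reward] on the parameters adds only a multiple of
    the mean score, which is 0. *)
Definition phi_deriv th h : R := uniform_mean S (fun x =>
  \sum_(y : L.-tuple V) policy f th x y * score th h x y * KL_reward th x y).

Variable v0 : V.

Section CurvePhi.
Variables (c : R -> 'rV[R]_p) (t : R) (h : 'rV[R]_p).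
Hypothesis c_h : is_derive t 1 c h.

Lemma is_derive_KL_reward x y :
  is_derive t 1 (fun u => KL_reward (c u) x y) (- lambda * score (c t) h x y).
Proof.
have d := is_derive_log_policy c_h x y.
apply: is_derive_eq (is_deriveB (is_derive_cst (rRM x y) t 1) (is_deriveZ lambda
  (is_deriveB d (is_derive_cst (log_policy theta_ref x y) t 1)))) _.
by rewrite subr0 sub0r mulNr.
Qed.

Lemma is_derive_phi : is_derive t 1
  (phi_RLHF f rRM lambda S theta_ref \o c) (phi_deriv (c t) h).
Proof.
rewrite phi_RLHFE; apply: is_derive_uniform_mean => x.
exact: (is_derive_expectation_score (fun u => sum_policy (c u) x v0)
  (is_derive_policy c_h x) (is_derive_KL_reward x)).
Qed.

End CurvePhi.

Lemma derive_phi th h :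
  'D_h (phi_RLHF f rRM lambda S theta_ref) th = phi_deriv th h.
Proof.
have [_ <-] : is_derive (0 : R) (1 : R)
    (phi_RLHF f rRM lambda S theta_ref \o line th h) (phi_deriv th h).
  by rewrite -{2}(line0 th h); exact: is_derive_phi (is_derive_line th h 0).
(* The difference quotients of the objective along [h] are those of its composition with [line th h]
   at time 0. *)
rewrite /derive /=; do 2 f_equal; apply/funext => u /=.
by rewrite line0 /line addr0 [u *: 1]mulr1.
Qed.

Lemma phi_deriv_gradient th h : phi_deriv th h =
  \sum_(i < p) h 0 i * gradient (phi_RLHF f rRM lambda S theta_ref) th 0 i.
Proof.
under eq_bigr => i _ do rewrite mxE derive_phi /phi_deriv /uniform_mean mulrA.
rewrite -mulr_suml; congr (_ / _).
under [RHS]eq_bigr => i _ do rewrite mulr_sumr.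
rewrite [RHS]exchange_big /=; apply: eq_bigr => x _.
under [RHS]eq_bigr => i _ do rewrite mulr_sumr.
rewrite [RHS]exchange_big /=; apply: eq_bigr => y _.
rewrite score_sum mulr_sumr mulr_suml; apply: eq_bigr => i _.
by ring.
Qed.

End Policy.

(** * Spectral norm *)

Section EuclideanNorm.
Context {R : realType}.

Lemma norm2_ge0 n (v : 'rV[R]_n) : 0 <= norm2 v.
Proof. exact: sqrtr_ge0. Qed.

Lemma norm2_sqr n (v : 'rV[R]_n) : norm2 v ^+ 2 = \sum_(i < n) v 0 i ^+ 2.
Proof. by rewrite sqr_sqrtr // sumr_ge0 // => i _; exact: sqr_ge0. Qed.

Lemma normr_le_norm2 n (v : 'rV[R]_n) i : `|v 0 i| <= norm2 v.
Proof.
rewrite -ler_sqr ?nnegrE ?norm2_ge0 // norm2_sqr (bigD1 i) //=.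
by rewrite real_normK ?num_real // lerDl sumr_ge0 // => j _; exact: sqr_ge0.
Qed.

Lemma norm2_eq0 n (v : 'rV[R]_n) : norm2 v = 0 -> v = 0.
Proof.
move=> v0; apply/rowP => i; rewrite mxE; apply/eqP.
by rewrite -normr_le0 -v0 normr_le_norm2.
Qed.

Lemma norm2Z n (a : R) (v : 'rV[R]_n) : norm2 (a *: v) = `|a| * norm2 v.
Proof.
rewrite /norm2 -sqrtr_sqr -sqrtrM ?sqr_ge0 // mulr_sumr.
by congr Num.sqrt; apply: eq_bigr => i _; rewrite mxE exprMn.
Qed.

(** On the unit ball every coordinate is at most 1 in absolute value, so absolute column sums bound
    the image. Only a bounded set makes the [sup] in [spectral_norm] an upper bound. *)
Lemma spectral_norm_has_ubound m n (A : 'M[R]_(m, n)) :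
  has_ubound [set norm2 (v *m A) | v in [set v : 'rV[R]_m | norm2 v <= 1]].
Proof.
exists (Num.sqrt (\sum_(j < n) (\sum_(i < m) `|A i j|) ^+ 2)) => _ [w w1 <-].
apply: ler_wsqrtr; apply: ler_sum => j _.
rewrite -real_normK ?num_real // ler_sqr ?nnegrE ?sumr_ge0 // mxE.
rewrite (le_trans (ler_norm_sum _ _ _)) //; apply: ler_sum => i _.
by rewrite normrM ler_piMl // (le_trans (normr_le_norm2 w i)).
Qed.

Lemma norm2_mulmx_le m n (A : 'M[R]_(m, n)) (v : 'rV[R]_m) :
  norm2 (v *m A) <= spectral_norm A * norm2 v.
Proof.
have [v0|v0] := eqVneq (norm2 v) 0.
  rewrite v0 mulr0 (norm2_eq0 v0) mul0mx -(scale0r (0 : 'rV_n)) norm2Z.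
  by rewrite normr0 mul0r.
have v_gt0 : 0 < norm2 v by rewrite lt_def v0 norm2_ge0.
rewrite -ler_pdivrMr // mulrC.
have -> : (norm2 v)^-1 * norm2 (v *m A) = norm2 ((norm2 v)^-1 *: v *m A).
  by rewrite -scalemxAl norm2Z ger0_norm // invr_ge0 ltW.
apply: ub_le_sup; first exact: spectral_norm_has_ubound.
exists ((norm2 v)^-1 *: v) => //=.
by rewrite norm2Z ger0_norm ?invr_ge0 ?norm2_ge0 // mulVf.
Qed.

End EuclideanNorm.

(** * Differential inequalities along the flow *)

Lemma cvg_dnbhs_split (R : realType) (T : topologicalType) (g : R -> T)
    (a : R) (l : T) :
  g h @[h --> a^'+] --> l -> g h @[h --> a^'-] --> l -> g h @[h --> a^'] --> l.
Proof.
move=> gr gl A lA.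
have Ar : \forall h \near a, a < h -> A (g h) by exact: gr.
have Al : \forall h \near a, h < a -> A (g h) by exact: gl.
suff : \forall h \near a, h != a -> A (g h) by [].
near=> h; rewrite neq_lt => /orP[ha|ah].
  by move: ha; near: h.
by move: ah; near: h.
Unshelve. all: by end_near. Qed.

Section FlowExtension.
Context {R : realType} {p : nat}.
Variables (phi : 'rV[R]_p -> R) (theta0 : 'rV[R]_p) (theta : R -> 'rV[R]_p).
Hypothesis flow : gradient_flow phi theta0 theta.

(* The linear extension to negative times makes the flow differentiable at 0
   on both sides. *)
Definition flow_ext (t : R) : 'rV[R]_p :=
  if 0 <= t then theta t else theta 0 + t *: gradient phi (theta 0).

Lemma flow_extE t : 0 <= t -> flow_ext t = theta t.
Proof. by rewrite /flow_ext => ->. Qed.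

(** At time 0 the right difference quotients converge by the flow equation and the left ones are
    constant; at a positive time the extension agrees with [theta] nearby. *)
Lemma is_derive_flow_ext (t : R) : 0 <= t ->
  is_derive t 1 flow_ext (gradient phi (flow_ext t)).
Proof.
move=> t0; rewrite (flow_extE t0); have [_ right0 pos] := flow.
move: t0; rewrite le_eqVlt => /predU1P[<-|t0].
  suff H : h^-1 *: ((flow_ext \o shift 0) (h *: 1) - flow_ext 0)
      @[h --> (0 : R)^'] --> gradient phi (theta 0).
    apply: DeriveDef; first by apply/cvg_ex; exists (gradient phi (theta 0)).
    exact: cvg_lim H.
  apply: cvg_dnbhs_split.
    apply: cvg_trans right0; apply: near_eq_cvg; near=> h => /=.
    by rewrite [h *: 1]mulr1 addr0 !flow_extE //; near: h; exact: nbhs_right_ge.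
  have cst : (fun=> gradient phi (theta 0)) h @[h --> (0 : R)^'-] -->
      gradient phi (theta 0) by exact: cvg_cst.
  apply: cvg_trans cst.
  apply: near_eq_cvg; near=> h => /=.
  have h0 : h < 0 by near: h; exact: nbhs_left_lt.
  rewrite [h *: 1]mulr1 addr0 (flow_extE (lexx 0)) /flow_ext leNgt h0 /=.
  by rewrite addrAC subrr add0r scalerA mulVf ?scale1r // lt_eqF.
apply: near_eq_is_derive (pos _ t0).
near=> u; rewrite flow_extE //; apply: ltW; near: u.
exact: lt_nbhsr.
Unshelve. all: by end_near. Qed.

End FlowExtension.

(** The sign is required on the open interval only: in the stationary case the gradient is shown to
    vanish only at positive times. *)
Lemma derive_ge0_le (R : realType) (F dF : R -> R) (tau : R) :
  (forall t, 0 <= t <= tau -> is_derive t 1 F (dF t)) ->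
  (forall t, 0 < t < tau -> 0 <= dF t) ->
  forall t, 0 <= t <= tau -> F 0 <= F t.
Proof.
move=> FdF dF0 t /andP[t0 tt].
have inW u : u \in `]0, tau[%R -> 0 <= u <= tau.
  by rewrite in_itv /= => /andP[/ltW -> /ltW ->].
apply: (@ger0_derive1_ndecr _ F 0 tau) => //.
- by move=> u /inW /FdF [].
- move=> u u0; have [_] := FdF u (inW u u0); rewrite derive1E => ->.
  by apply: dF0; move: u0; rewrite in_itv.
- apply: derivable_within_continuous => u; rewrite in_itv /= => /FdF.
  by case.
Qed.

(* The energy inequality [u' <= 4 a u^(3/2)] makes [u^(-1/2) + 2 a t]
   nondecreasing; adding [3 u 0] to [u] keeps the inverse square root smooth. *)
Lemma energy_growth (R : realType) (e u de du : R -> R) (a tau : R) :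
  0 <= tau -> 0 <= a -> 0 < u 0 -> 8 * a * Num.sqrt (u 0) * tau <= 1 ->
  (forall t, 0 <= u t) ->
  (forall t, 0 <= t <= tau -> is_derive t 1 e (de t)) ->
  (forall t, 0 <= t <= tau -> is_derive t 1 u (du t)) ->
  (forall t k, 0 <= t <= tau -> 0 < k -> u t <= k ^+ 2 ->
     du t <= 4 * a * k ^+ 3 /\ de t <= 4 * a * k) ->
  e tau - e 0 <= 16 * a * Num.sqrt (u 0) * tau.
Proof.
move=> tau0 a0 u0 small u_ge0 ede udu bnd.
set v := u 0 in u0 small *.
(* The factor 3 makes [k 0] exactly [2 * Num.sqrt v]. *)
pose k t := Num.sqrt (u t + 3 * v).
have uv t : 0 < u t + 3 * v by have := u_ge0 t; lra.
have k0 t : 0 < k t by rewrite sqrtr_gt0.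
have uk t : u t <= k t ^+ 2.
  by rewrite sqr_sqrtr; [lra|exact: ltW].
have sv : 0 < Num.sqrt v by rewrite sqrtr_gt0.
have k00 : k 0 = 2 * Num.sqrt v.
  rewrite /k -/v (_ : v + 3 * v = 2 ^+ 2 * v); last by ring.
  by rewrite sqrtrM ?sqr_ge0 // sqrtr_sqr ger0_norm.
have dk t : 0 <= t <= tau -> is_derive t 1 k ((2 * k t)^-1 * du t).
  move=> tt; have d := is_deriveD (udu t tt) (is_derive_cst (3 * v) t 1).
  by have := @is_derive1_comp R Num.sqrt (fun s => u s + 3 * v) t _ _
    (is_derive1_sqrt (uv t)) d; rewrite addr0.
have dw t : 0 <= t <= tau -> is_derive t 1 (fun s => (k s)^-1 + 2 * a * s)
    (- (k t) ^- 2 * ((2 * k t)^-1 * du t) + 2 * a).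
  move=> tt; have d := is_deriveV (lt0r_neq0 (k0 t)) (dk t tt).
  by have := is_deriveD d (is_deriveZ (2 * a) (is_derive_id t 1));
    rewrite [_ *: 1]mulr1.
have k4 t : 0 <= t <= tau -> k t <= 4 * Num.sqrt v.
  move=> /[dup] tt /andP[t0 ttau].
  have : (k 0)^-1 + 2 * a * 0 <= (k t)^-1 + 2 * a * t.
    apply: (derive_ge0_le dw) => // s /andP[/ltW s0 /ltW stau].
    have ss : 0 <= s <= tau by rewrite s0.
    have [du_le _] := bnd s (k s) ss (k0 s) (uk s).
    have -> : - k s ^- 2 * ((2 * k s)^-1 * du s) + 2 * a =
        (4 * a * k s ^+ 3 - du s) / (2 * k s ^+ 3).
      by field; rewrite gt_eqF.
    by rewrite divr_ge0 ?subr_ge0 // mulr_ge0 // ltW ?exprn_gt0.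
  rewrite k00 mulr0 addr0 => kt.
  rewrite -lef_pV2 ?posrE ?mulr_gt0 //.
  (* The smallness assumption lets [(k t)^-1] lose at most half of its initial value
     [(2 * Num.sqrt v)^-1], so [k] at most doubles. *)
  have at_le : 2 * a * t <= (4 * Num.sqrt v)^-1.
    rewrite -div1r ler_pdivlMr ?mulr_gt0 //; apply: le_trans small.
    have : a * Num.sqrt v * t <= a * Num.sqrt v * tau.
      by rewrite ler_wpM2l // mulr_ge0 // ltW.
    lra.
  have : (2 * Num.sqrt v)^-1 = 2 * (4 * Num.sqrt v)^-1 by field; rewrite gt_eqF.
  lra.
have H : 16 * a * Num.sqrt v * 0 - e 0 <= 16 * a * Num.sqrt v * tau - e tau.
  apply: (@derive_ge0_le R (fun s => 16 * a * Num.sqrt v * s - e s)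
    (fun s => 16 * a * Num.sqrt v - de s) tau); last by rewrite tau0 lexx.
  - move=> s ss; have := is_deriveB
      (is_deriveZ (16 * a * Num.sqrt v) (is_derive_id s 1)) (ede s ss).
    by rewrite [_ *: 1]mulr1.
  - move=> s /andP[/ltW s0 /ltW stau]; have ss : 0 <= s <= tau by rewrite s0.
    have [_ de_le] := bnd s (k s) ss (k0 s) (uk s).
    rewrite subr_ge0 (le_trans de_le) //.
    have : a * k s <= a * (4 * Num.sqrt v) by rewrite ler_wpM2l // k4.
    lra.
lra.
Qed.

(** * Averages over the training prompts *)

Section UniformMean.
Context {R : realType} {T : choiceType}.
Variable S : {fset T}.
Implicit Types F G : T -> R.

Lemma ler_uniform_mean F G : (forall x, x \in S -> F x <= G x) ->
  uniform_mean S F <= uniform_mean S G.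
Proof.
move=> FG; rewrite ler_wpM2r ?invr_ge0 // big_seq [leRHS]big_seq.
by apply: ler_sum => x xS; exact: FG.
Qed.

Lemma uniform_mean_ge0 F : (forall x, x \in S -> 0 <= F x) ->
  0 <= uniform_mean S F.
Proof. by move=> F0; rewrite mulr_ge0 ?invr_ge0 // big_seq sumr_ge0. Qed.

Lemma uniform_mean_affine (a b : R) F G :
  uniform_mean S (fun x => a * F x + b * G x) =
  a * uniform_mean S F + b * uniform_mean S G.
Proof. by rewrite /uniform_mean big_split /= -!mulr_sumr mulrDl !mulrA. Qed.

Lemma uniform_meanZ (a : R) F :
  uniform_mean S (fun x => a * F x) = a * uniform_mean S F.
Proof. by rewrite /uniform_mean -mulr_sumr mulrA. Qed.

Lemma uniform_mean_cst (a : R) : S != fset0 -> uniform_mean S (fun=> a) = a.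
Proof.
move=> S0; rewrite /uniform_mean big_const_seq count_predT iter_addr_0.
by rewrite -[a *+ _]mulr_natr mulfK // pnatr_eq0 cardfs_eq0.
Qed.

Lemma uniform_mean_eq0 F : S != fset0 -> (forall x, x \in S -> 0 <= F x) ->
  uniform_mean S F = 0 -> forall x, x \in S -> F x = 0.
Proof.
move=> S0 F0 /eqP; rewrite mulf_eq0 invr_eq0 pnatr_eq0 cardfs_eq0 (negbTE S0) orbF.
by rewrite big_seq psumr_eq0 // => /allP F_0 x xS; apply/eqP/(implyP (F_0 x xS)).
Qed.

End UniformMean.

(** * Bounds on the gradient and on rates of change along the flow *)

Section GradientBound.
Context {R : realType} {V : finType} {L p : nat}.
Variable f : 'rV[R]_p -> seq V -> 'rV[R]_#|V|.
Hypothesis f_diff : forall (s : seq V) th, differentiable (f^~ s) th.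
Variables (rRM : seq V -> L.-tuple V -> R) (lambda : R) (theta_ref : 'rV[R]_p).
Variable S : {fset (seq V)}.
Hypothesis S_neq0 : S != fset0.
Variable v0 : V.

Local Notation phi := (phi_RLHF f rRM lambda S theta_ref).
Local Notation g := (KL_reward f rRM lambda theta_ref).

(** The energy of the differential inequality: the variance is that of the penalized reward, and it
    reduces to the variance of [rRM] at [theta_ref]. *)
Definition mean_variance (th : 'rV[R]_p) : R :=
  uniform_mean S (fun x => fin_variance (policy f th x) (g th x)).

Lemma phi_deriv_norm2 (th : 'rV[R]_p) :
  phi_deriv f rRM lambda theta_ref S th (gradient phi th) =
  norm2 (gradient phi th) ^+ 2.
Proof.
by rewrite phi_deriv_gradient // norm2_sqr; apply: eq_bigr => i _; rewrite expr2.
Qed.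

Lemma normr_score_norm2 (th h : 'rV[R]_p) (x : seq V) (y : L.-tuple V) (j : R) :
  (forall l : 'I_L, spectral_norm ('J (f^~ (x ++ take l y)) th) <= j) ->
  `|score f th h x y| <= 2 * L%:R * (j * norm2 h).
Proof.
move=> Jj; apply: normr_score => l w.
rewrite (le_trans (normr_le_norm2 _ _)) // (le_trans (norm2_mulmx_le _ _)) //.
by rewrite ler_wpM2r ?norm2_ge0.
Qed.

(* AM-GM: [|g - m| <= ((g - m)^2 / k + k) / 2]. *)
Lemma mean_deviation_le (th : 'rV[R]_p) (k : R) (x : seq V) : 0 < k ->
  fin_expectation (policy f th x)
    (fun y => `|g th x y - fin_expectation (policy f th x) (g th x)|) <=
  (2 * k)^-1 * fin_variance (policy f th x) (g th x) + k / 2 * 1.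
Proof.
move=> k0; rewrite /fin_variance; set m := fin_expectation _ (g th x).
rewrite /fin_expectation -[X in _ + _ * X](sum_policy f th x v0 (L := L)).
rewrite !mulr_sumr -big_split /=.
apply: ler_sum => y _.
set d := g th x y - m; have P0 := policy_gt0 f th x y.
rewrite [leRHS](_ : _ = policy f th x y * ((2 * k)^-1 * d ^+ 2 + k / 2));
  last by ring.
rewrite ler_pM2l // -(real_normK (num_real d)) -subr_ge0.
have -> : (2 * k)^-1 * `|d| ^+ 2 + k / 2 - `|d| = (2 * k)^-1 * (`|d| - k) ^+ 2.
  by field; rewrite gt_eqF.
by rewrite mulr_ge0 ?sqr_ge0 // invr_ge0 mulr_ge0 // ltW.
Qed.

(** The squared gradient norm is the derivative of the objective along its own gradient. It is at
    most [2 * L%:R * j] times the gradient norm times the mean absolute deviation, which AM-GM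
    bounds by [k]; one factor of the norm then cancels. *)
Lemma gradient_norm2_le (th : 'rV[R]_p) (j k : R) : 0 <= j -> 0 < k ->
  (forall (x : seq V) (y : L.-tuple V) (l : 'I_L), x \in S ->
     spectral_norm ('J (f^~ (x ++ take l y)) th) <= j) ->
  mean_variance th <= k ^+ 2 ->
  norm2 (gradient phi th) <= 2 * L%:R * j * k.
Proof.
move=> j0 k0 Jj uk; set N := norm2 _.
have N0 : 0 <= N := norm2_ge0 _.
have [->|N_neq0] := eqVneq N 0; first by rewrite !mulr_ge0 // ltW.
have N_gt0 : 0 < N by rewrite lt_def N_neq0.
rewrite -(ler_pM2l N_gt0) -[leLHS]expr2 -phi_deriv_norm2.
set B := 2 * L%:R * (j * N).
have B0 : 0 <= B by rewrite !mulr_ge0.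
apply: (@le_trans _ _ (B * ((2 * k)^-1 * mean_variance th + k / 2))).
  rewrite -[k / 2]mulr1 -[X in _ + _ * X](uniform_mean_cst 1 S_neq0).
  rewrite -uniform_mean_affine.
  rewrite -uniform_meanZ; apply: ler_uniform_mean => x xS.
  apply: le_trans (ler_wpM2l B0 (mean_deviation_le th x k0)).
  set m := fin_expectation _ (g th x).
  (* The reward may be centered because the score has mean 0. *)
  have -> : \sum_y policy f th x y * score f th (gradient phi th) x y * g th x y =
      \sum_y policy f th x y * score f th (gradient phi th) x y * (g th x y - m).
    under [RHS]eq_bigr => y _ do rewrite mulrBr.
    by rewrite sumrB -mulr_suml sum_policy_score // mul0r subr0.
  apply: sum_mul_le_expectation => y; first exact/ltW/policy_gt0.
  by apply: normr_score_norm2 => l; exact: Jj.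
have -> : N * (2 * L%:R * j * k) = B * k by rewrite /B; ring.
rewrite ler_wpM2l //.
have : (2 * k)^-1 * mean_variance th <= (2 * k)^-1 * k ^+ 2.
  by rewrite ler_wpM2l // invr_ge0 mulr_ge0 // ltW.
have -> : (2 * k)^-1 * k ^+ 2 = k / 2 by field; rewrite gt_eqF.
lra.
Qed.

Variable theta : R -> 'rV[R]_p.
Variable t : R.
Hypothesis theta_t : is_derive t 1 theta (gradient phi (theta t)).

Local Notation s := (score (L := L) f (theta t) (gradient phi (theta t))).

Definition mean_variance_deriv : R := uniform_mean S (fun x =>
  \sum_y policy f (theta t) x y * s x y *
    (g (theta t) x y - fin_expectation (policy f (theta t) x) (g (theta t) x)) ^+ 2)
  - 2 * lambda * norm2 (gradient phi (theta t)) ^+ 2.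

Lemma is_derive_mean_variance :
  is_derive t 1 (fun u => mean_variance (theta u)) mean_variance_deriv.
Proof.
rewrite /mean_variance_deriv -phi_deriv_norm2 -mulNr -[X in X + _]mul1r.
rewrite -uniform_mean_affine; apply: is_derive_uniform_mean => x.
rewrite mul1r mulNr.
exact: (is_derive_variance (fun u => sum_policy f (theta u) x v0)
  (is_derive_policy f_diff theta_t x)
  (is_derive_KL_reward f_diff rRM lambda theta_ref theta_t x)).
Qed.

Hypothesis lambda_ge0 : 0 <= lambda.

(** By the gradient bound, scores are at most [4 * a * k] with [a = L%:R ^+ 2 * j ^+ 2]. The first
    estimate drops the nonpositive damping term and multiplies by the variance, at most [k ^+ 2];
    the second multiplies by the mean of [|r|], at most 1. *)
Lemma flow_bounds (j k : R) : 0 <= j -> 0 < k ->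
  (forall (x : seq V) (y : L.-tuple V) (l : 'I_L), x \in S ->
     spectral_norm ('J (f^~ (x ++ take l y)) (theta t)) <= j) ->
  mean_variance (theta t) <= k ^+ 2 ->
  mean_variance_deriv <= 4 * (L%:R ^+ 2 * j ^+ 2) * k ^+ 3 /\
  forall (x : seq V) (r : L.-tuple V -> R),
    (forall (y : L.-tuple V) (l : 'I_L),
      spectral_norm ('J (f^~ (x ++ take l y)) (theta t)) <= j) ->
    (forall y, -1 <= r y <= 1) ->
    \sum_y policy f (theta t) x y * s x y * r y <=
      4 * (L%:R ^+ 2 * j ^+ 2) * k.
Proof.
move=> j0 k0 Jj uk; have Nle := gradient_norm2_le j0 k0 Jj uk.
set N := norm2 _ in Nle *; set a := L%:R ^+ 2 * j ^+ 2.
have Bk : 2 * L%:R * (j * N) <= 4 * a * k.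
  rewrite (_ : 4 * a * k = 2 * L%:R * (j * (2 * L%:R * j * k)));
    last by rewrite /a; ring.
  by rewrite !ler_wpM2l.
have a0 : 0 <= 4 * a * k by rewrite !mulr_ge0 ?sqr_ge0 // ltW.
split=> [|x r Jx r1].
  apply: (@le_trans _ _ (4 * a * k * mean_variance (theta t))); last first.
    by rewrite (_ : 4 * a * k ^+ 3 = 4 * a * k * k ^+ 2) ?ler_wpM2l //; ring.
  rewrite lerBlDr -[leLHS]addr0 lerD //;
    last by rewrite mulr_ge0 ?sqr_ge0 // mulr_ge0.
  rewrite -uniform_meanZ; apply: ler_uniform_mean => x xS.
  set m := fin_expectation _ _.
  rewrite /fin_variance -/m.
  under [X in _ <= _ * fin_expectation _ X]funext => y do
    rewrite -(ger0_norm (sqr_ge0 (g (theta t) x y - m))).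
  apply: sum_mul_le_expectation => y; first exact/ltW/policy_gt0.
  by apply: le_trans Bk; apply: normr_score_norm2 => l; exact: Jj.
apply: (@le_trans _ _ (4 * a * k * fin_expectation (policy f (theta t) x)
    (fun y => `|r y|))).
  apply: sum_mul_le_expectation => y; first exact/ltW/policy_gt0.
  by apply: le_trans Bk; apply: normr_score_norm2.
rewrite -[leRHS]mulr1 ler_wpM2l // -(sum_policy f (theta t) x v0 (L := L)).
apply: ler_sum => y _; rewrite ler_piMr ?ler_norml //.
exact/ltW/policy_gt0.
Qed.

End GradientBound.

(** * Hitting times and expected rewards along the flow *)

Lemma is_derive_continuous (R : realType) (F : R -> R) (t d : R) :
  is_derive t 1 F d -> {for t, continuous F}.
Proof. by case=> /derivable1_diffP dF _; exact: differentiable_continuous. Qed.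

(** If [F tau < c], continuity keeps [F] below [c] around [tau], yet the infimum has points of the
    set arbitrarily close on its right. *)
Lemma ereal_inf_attained (R : realType) (F : R -> R) (c tau : R) :
  {for tau, continuous F} ->
  ereal_inf [set t%:E | t in [set t : R | 0 <= t /\ c <= F t]] = tau%:E ->
  0 <= tau /\ c <= F tau.
Proof.
move=> Fc inf_tau; split.
  rewrite -lee_fin -inf_tau; apply: le_ereal_inf_tmp => _ [t [t0 _] <-].
  by rewrite lee_fin.
rewrite leNgt; apply/negP => Flt.
have /= : \forall u \near tau, F u < c by exact: Fc (lt_nbhsl Flt).
move=> [d /= d0 dF].
have : (ereal_inf [set t%:E | t in [set t : R | (0 <= t)%R /\ (c <= F t)%R]] <
    (tau + d)%:E)%E.
  by rewrite inf_tau lte_fin ltrDl.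
move=> /ereal_inf_lt [_ [t [t0 cF] <-]]; rewrite lte_fin => td.
have taut : tau <= t.
  by rewrite -lee_fin -inf_tau; apply: ereal_inf_lbound; exists t.
suff : F t < c by rewrite ltNge cF.
by apply: dF => /=; rewrite distrC ger0_norm ?subr_ge0 // ltrBlDl.
Qed.

(** For a base at most 1 the smaller exponent gives the larger power; this passes from the square
    root of the energy estimate to the cube root of the stated bound. *)
Lemma root3_ge_sqrt (R : realType) (v : R) : 0 < v <= 1 ->
  Num.sqrt v <= v `^ (1 / 3).
Proof.
move=> /[dup] v01 /andP[v0 _]; rewrite -powR12_sqrt; last exact: ltW.
by apply: ger_powR => //; lra.
Qed.

Section GradientFlow.
Context {R : realType} {V : finType} {L p : nat}.
Variable f : 'rV[R]_p -> seq V -> 'rV[R]_#|V|.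
Hypothesis f_diff : forall (s : seq V) th, differentiable (f^~ s) th.
Variables (rRM : seq V -> L.-tuple V -> R) (lambda : R) (theta_ref : 'rV[R]_p).
Hypothesis lambda_ge0 : 0 <= lambda.
Variable S : {fset (seq V)}.
Hypothesis S_neq0 : S != fset0.
Variable v0 : V.
Variable theta : R -> 'rV[R]_p.

Local Notation phi := (phi_RLHF f rRM lambda S theta_ref).

Hypothesis theta0 : theta 0 = theta_ref.
Hypothesis dtheta : forall t : R, 0 <= t ->
  is_derive t 1 theta (gradient phi (theta t)).

Lemma KL_reward_ref x y : KL_reward f rRM lambda theta_ref theta_ref x y = rRM x y.
Proof. by rewrite /KL_reward subrr mulr0 subr0. Qed.

Lemma mean_variance_ref :
  mean_variance f rRM lambda theta_ref S theta_ref =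
  uniform_mean S (fun x => fin_variance (policy f theta_ref x) (rRM x)).
Proof.
congr (_ / _); apply: eq_bigr => x _; congr fin_variance.
by apply/funext => y; rewrite KL_reward_ref.
Qed.

Lemma is_derive_flow_expectation (x : seq V) (r : L.-tuple V -> R) (t : R) :
  0 <= t ->
  is_derive t 1 (fun u => fin_expectation (policy f (theta u) x) r)
    (\sum_y policy f (theta t) x y *
      score f (theta t) (gradient phi (theta t)) x y * r y).
Proof.
move=> t0; exact: (is_derive_expectation_cst
  (is_derive_policy f_diff (dtheta t0) x)).
Qed.

(* When the reward is constant on every training prompt, [theta_ref] maximizes
   the objective, so the objective cannot increase along the flow. *)
Lemma stationary_flow_expectation (x : seq V) (r : L.-tuple V -> R) (t : R) :
  uniform_mean S (fun x' => fin_variance (policy f (theta 0) x') (rRM x')) = 0 ->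
  0 <= t -> fin_expectation (policy f (theta t) x) r =
            fin_expectation (policy f (theta 0) x) r.
Proof.
move=> var0 t_ge0.
have rRM_cst x' : x' \in S ->
    forall y, rRM x' y = fin_expectation (policy f (theta 0) x') (rRM x').
  move=> x'S; apply: fin_variance_eq0 => [y|]; first exact: policy_gt0.
  apply: (uniform_mean_eq0 S_neq0 _ var0) x'S => z _.
  by apply: fin_variance_ge0 => y; exact/ltW/policy_gt0.
have E_cst th x' : x' \in S -> fin_expectation (policy f th x') (rRM x') =
    fin_expectation (policy f (theta 0) x') (rRM x').
  move=> x'S; rewrite {1}/fin_expectation.
  under eq_bigr => y _ do rewrite (rRM_cst x' x'S y).
  by rewrite -mulr_suml (sum_policy f th x' v0) mul1r.
(* The expected reward is the same for all parameters, and the KL penalty is nonnegative and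
   vanishes at [theta_ref]. *)
have phi_max th : phi th <= phi (theta 0).
  rewrite /phi_RLHF; apply: ler_uniform_mean => x' x'S.
  rewrite E_cst // lerD2l lerN2.
  rewrite ler_wpM2l // theta0 (_ : KL (policy f theta_ref x') _ = 0).
    apply: KL_ge0; (try by move=> y; exact: policy_gt0);
    exact: sum_policy v0.
  rewrite /KL big1 // => y _.
  by rewrite divff ?ln1 ?mulr0 // gt_eqF // policy_gt0.
have dphi (u : R) : 0 <= u -> is_derive u 1 (phi \o theta)
    (norm2 (gradient phi (theta u)) ^+ 2).
  by move=> u0; rewrite -phi_deriv_norm2 //; exact: is_derive_phi (dtheta u0).
have phi_cst (u : R) : 0 <= u -> (phi \o theta) u = (phi \o theta) 0.
  move=> u0; apply/eqP; rewrite eq_le; apply/andP; split; first exact: phi_max.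
  apply: (@derive_ge0_le _ (phi \o theta)
    (fun s => norm2 (gradient phi (theta s)) ^+ 2) u _ _ u).
  - by move=> s /andP[s0 _]; exact: dphi.
  - by move=> s _; exact: sqr_ge0.
  - by rewrite u0 lexx.
(* The objective is constant along the flow and its derivative is the squared gradient norm. The
   maximum criterion needs an open interval around [u], hence [0 < u]. *)
have grad0 (u : R) : 0 < u -> gradient phi (theta u) = 0.
  move=> u0; apply/norm2_eq0/eqP; rewrite -sqrf_eq0; apply/eqP.
  have inW s : s \in `]0, (2 * u)[%R -> 0 <= s.
    by rewrite in_itv /= => /andP[/ltW].
  have [_ <-] := dphi u (ltW u0).
  suff [] : is_derive u 1 (phi \o theta) 0 by [].
  apply: (@derive1_at_max _ _ 0 (2 * u)).
  - by rewrite mulr_ge0 // ltW.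
  - by move=> s /inW /dphi [].
  - by rewrite in_itv /= u0; lra.
  - by move=> s /inW s0; rewrite !phi_cst // ltW.
have dE (r' : L.-tuple V -> R) (u : R) : 0 < u -> \sum_y policy f (theta u) x y *
      score f (theta u) (gradient phi (theta u)) x y * r' y = 0.
  move=> u0; rewrite grad0 // big1 // => y _.
  by rewrite score_sum big1 ?mulr0 ?mul0r // => i _; rewrite mxE mul0r.
(* Stated for every reward so that [r] and its opposite give the two inequalities. *)
have mono (r' : L.-tuple V -> R) : fin_expectation (policy f (theta 0) x) r' <=
    fin_expectation (policy f (theta t) x) r'.
  apply: (derive_ge0_le (tau := t)
    (F := fun u => fin_expectation (policy f (theta u) x) r')).
  - by move=> s /andP[s0 _]; exact: is_derive_flow_expectation.
  - by move=> s /andP[s0 _]; rewrite dE.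
  - by rewrite t_ge0 lexx.
have expN th : fin_expectation (policy f th x) (fun y => - r y) =
    - fin_expectation (policy f th x) r.
  by rewrite /fin_expectation -sumrN; apply: eq_bigr => y _; rewrite mulrN.
by apply/eqP; rewrite eq_le mono andbT -lerN2 -!expN mono.
Qed.

(** This is [energy_growth] for the expected reward and [mean_variance], whose value at time 0 is
    [v] because the penalty is zero there. *)
Lemma flow_expectation_increase (X : set (seq V)) (x : seq V)
    (r : L.-tuple V -> R) (j tau : R) :
  X x -> (forall x', x' \in S -> X x') -> 0 <= j -> 0 <= tau ->
  (forall (x' : seq V) (y : L.-tuple V) (l : 'I_L) (t : R),
    X x' -> 0 <= t <= tau ->
    spectral_norm ('J (f^~ (x' ++ take l y)) (theta t)) <= j) ->
  (forall y, -1 <= r y <= 1) ->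
  let v := uniform_mean S
    (fun x' => fin_variance (policy f (theta 0) x') (rRM x')) in
  let a := L%:R ^+ 2 * j ^+ 2 in
  0 < v -> 8 * a * Num.sqrt v * tau <= 1 ->
  fin_expectation (policy f (theta tau) x) r -
    fin_expectation (policy f (theta 0) x) r <= 16 * a * Num.sqrt v * tau.
Proof.
move=> Xx SX j0 tau0 Jj r1 /=.
set v := uniform_mean _ _; set a := L%:R ^+ 2 * j ^+ 2 => v_gt0 small.
pose u t := mean_variance f rRM lambda theta_ref S (theta t).
have u0 : u 0 = v by rewrite /u theta0 mean_variance_ref /v theta0.
rewrite -u0 in v_gt0 small *.
pose e t := fin_expectation (policy f (theta t) x) r.
pose de t := \sum_y policy f (theta t) x y *
  score f (theta t) (gradient phi (theta t)) x y * r y.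
pose du := mean_variance_deriv f rRM lambda theta_ref S theta.
have a0 : 0 <= a by rewrite mulr_ge0 ?sqr_ge0.
have u_ge0 t : 0 <= u t.
  apply: uniform_mean_ge0 => z _; apply: fin_variance_ge0 => y.
  exact/ltW/policy_gt0.
have dE t : 0 <= t <= tau -> is_derive t 1 e (de t).
  by move=> /andP[t0 _]; exact: is_derive_flow_expectation.
have dU t : 0 <= t <= tau -> is_derive t 1 u (du t).
  by move=> /andP[t0 _]; exact: is_derive_mean_variance (dtheta t0).
have bounds t k : 0 <= t <= tau -> 0 < k -> u t <= k ^+ 2 ->
    du t <= 4 * a * k ^+ 3 /\ de t <= 4 * a * k.
  move=> tt k0 uk.
  have JS (x' : seq V) (y : L.-tuple V) (l : 'I_L) : x' \in S ->
      spectral_norm ('J (f^~ (x' ++ take l y)) (theta t)) <= j.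
    by move=> /SX Xx'; exact: Jj.
  have [du_le de_le] := flow_bounds f_diff S_neq0 v0 lambda_ge0 j0 k0 JS uk.
  by split=> //; apply: de_le => // y l; exact: Jj.
exact: (energy_growth tau0 a0 v_gt0 small u_ge0 dE dU bounds).
Qed.

End GradientFlow.

(** * The lower bound on the hitting time *)

Unset Implicit Arguments.

Theorem theorem4 (R : realType) (V : finType) (L p : nat) (X : set (seq V))
  (f : 'rV[R]_p -> seq V -> 'rV[R]_#|V|)
  (f_diff : forall (s : seq V) (th : 'rV[R]_p),
     differentiable (fun th' : 'rV[R]_p => f th' s) th)
  (rRM : seq V -> L.-tuple V -> R)
  (rRM_bound : forall (x : seq V) (y : L.-tuple V), X x -> -1 <= rRM x y <= 1)
  (lambda : R) (lambda_ge0 : 0 <= lambda)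
  (S : {fset (seq V)}) (S_neq0 : S != fset0)
  (S_sub : forall x : seq V, x \in S -> X x)
  (theta_ref : 'rV[R]_p) (theta : R -> 'rV[R]_p)
  (theta_flow :
     gradient_flow (phi_RLHF f rRM lambda S theta_ref) theta_ref theta)
  (gamma : R) (gamma_gt0 : 0 < gamma)
  (x : seq V) (Xx : X x)
  (r : seq V -> L.-tuple V -> R)
  (r_bound : forall (x' : seq V) (y : L.-tuple V), X x' -> -1 <= r x' y <= 1) :
  let t_gamma := hitting_time f theta x r gamma in
  let J := jacobian_sup L X f theta t_gamma in
  let v := uniform_mean S
    (fun x' : seq V => fin_variance (policy f (theta 0) x') (rRM x')) in
  (time_lower_bound L gamma lambda v J <= t_gamma)%E.
Proof.
cbv zeta; set t_gamma := hitting_time _ _ _ _ _.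
set J := jacobian_sup _ _ _ _ _; set v := uniform_mean _ _.
have never : (forall t : R, 0 <= t ->
    fin_expectation (policy f (theta t) x) (r x) =
    fin_expectation (policy f (theta 0) x) (r x)) -> t_gamma = +oo%E.
  move=> cst; apply: hitting_time_never => t t0.
  by rewrite (cst t t0) ltrDl.
(* Without tokens no output has a position, so the policy does not depend on the parameters. *)
have [v0 _|V_empty] := pickP [pred _ : V | true]; last first.
  rewrite never ?leey // => t _; apply: eq_bigr => y _; congr (_ * _).
  by apply: eq_bigr => l _; have := V_empty (tnth y l).
pose phi := phi_RLHF f rRM lambda S theta_ref.
(* The flow lemmas ask for a two-sided derivative at time 0, which [theta] may lack; [eta] has it
   and agrees with [theta] at nonnegative times. *)
pose eta := flow_ext phi theta.
have etaE (t : R) : 0 <= t -> eta t = theta t by move=> ?; exact: flow_extE.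
have deta (t : R) : 0 <= t -> is_derive t 1 eta (gradient phi (eta t)).
  exact: (is_derive_flow_ext theta_flow).
have eta0 : eta 0 = theta_ref by rewrite etaE //; case: theta_flow.
have vE : v = uniform_mean S
    (fun x' => fin_variance (policy f (eta 0) x') (rRM x')) by rewrite etaE.
have [var0|var_neq0] := eqVneq v 0.
  rewrite never ?leey // => t t0; rewrite -!etaE //.
  apply: (stationary_flow_expectation f_diff lambda_ge0 S_neq0 v0 eta0 deta) => //.
  by rewrite -vE.
have v_ge0 : 0 <= v.
  by apply: uniform_mean_ge0 => z _; apply: fin_variance_ge0 => y;
    exact/ltW/policy_gt0.
have v_gt0 : 0 < v by rewrite lt_def var_neq0.
have v_le1 : v <= 1.
  rewrite -(uniform_mean_cst 1 S_neq0); apply: ler_uniform_mean => z zS.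
  apply: fin_variance_le1 => [y||y]; first exact/ltW/policy_gt0.
    exact: sum_policy v0.
  exact/rRM_bound/S_sub.
have t_gammaE : t_gamma = hitting_time f eta x r gamma.
  have reachedE : [set t : R | 0 <= t /\
      fin_expectation (policy f (theta 0) x) (r x) + gamma <=
      fin_expectation (policy f (theta t) x) (r x)] =
    [set t : R | 0 <= t /\
      fin_expectation (policy f (eta 0) x) (r x) + gamma <=
      fin_expectation (policy f (eta t) x) (r x)].
    rewrite [eta 0]etaE //.
    by apply/seteqP; split=> t /= [t0 reached_t]; move: reached_t; rewrite etaE.
  by rewrite /t_gamma /hitting_time reachedE.
have t_gamma_ge0 : (0 <= t_gamma)%E.
  by apply: le_ereal_inf_tmp => _ [t [t0 _] <-]; rewrite lee_fin.
have J_ub (x' : seq V) (y : L.-tuple V) (l : 'I_L) (t : R) : X x' ->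
    0 <= t -> (t%:E <= t_gamma)%E ->
    ((spectral_norm ('J (f^~ (x' ++ take l y)) (eta t)))%:E <= J)%E.
  move=> Xx' t0 t_le; rewrite etaE //.
  by apply: ereal_sup_ubound; exists x', y, l, t; split.
clearbody J v t_gamma; rewrite /time_lower_bound (negbTE var_neq0) /=.
case tau_eq : t_gamma t_gamma_ge0 => [tau| |] // t_gamma_ge0; last by rewrite leey.
have [tau0 reached] : 0 <= tau /\
    fin_expectation (policy f (eta 0) x) (r x) + gamma <=
    fin_expectation (policy f (eta tau) x) (r x).
  have tau_ge0 : 0 <= tau.
    by rewrite -lee_fin.
  apply: (@ereal_inf_attained _
    (fun t => fin_expectation (policy f (eta t) x) (r x))).
    exact: is_derive_continuous
      (is_derive_flow_expectation f_diff deta x (r x) tau_ge0).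
  by rewrite -tau_eq t_gammaE.
have [J_oo|J_fin] := eqVneq J +oo%E.
  by rewrite J_oo /= lee_fin.
(* The maximum provides [0 <= j] at once, also when [J] is [-oo], the supremum of an empty set if
   [L = 0]. *)
pose j := Num.max 0 (fine J).
have j0 : 0 <= j by rewrite le_max lexx.
have Jj (x' : seq V) (y : L.-tuple V) (l : 'I_L) (t : R) : X x' ->
    0 <= t <= tau ->
    spectral_norm ('J (f^~ (x' ++ take l y)) (eta t)) <= j.
  move=> Xx' /andP[t0 ttau].
  have := J_ub x' y l t Xx' t0; rewrite tau_eq lee_fin => /(_ ttau).
  rewrite /j le_max orbC; case: (J) J_fin => [s| |] //= _.
  by rewrite lee_fin => ->.
set a := L%:R ^+ 2 * j ^+ 2.
have a0 : 0 <= a by rewrite mulr_ge0 ?sqr_ge0.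
have bound th := fin_expectation_itv (fun y => ltW (policy_gt0 f th x y))
  (sum_policy f th x v0) (fun y => r_bound x y Xx).
have gamma_le2 : gamma <= 2.
  by have := bound (eta 0); have := bound (eta tau); lra.
(* Otherwise [gamma <= 2] gives [8 * a * Num.sqrt v * tau < 2 / 9], so the growth estimate applies
   and the reward gains less than [16 / 72 * gamma]. The 72 is the product of the 8 and the 9 of the
   stated bound. *)
have key : gamma <= 72 * (a * Num.sqrt v * tau).
  rewrite leNgt; apply/negP => small.
  have := flow_expectation_increase f_diff lambda_ge0 S_neq0 v0 eta0 deta
    Xx S_sub j0 tau0 Jj (fun y => r_bound x y Xx).
  rewrite -vE -/a => /(_ v_gt0) increase.
  have : 8 * a * Num.sqrt v * tau <= 1 by lra.
  by move=> /increase; lra.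
(* With [a = 0], [key] would contradict [0 < gamma]; hence [J] is neither 0 nor [-oo]. *)
have a_gt0 : 0 < a.
  rewrite lt_def a0 andbT; apply/negP => /eqP a_eq0.
  by move: key; rewrite a_eq0 !mul0r mulr0; lra.
have jE : j = fine J.
  move: a_gt0; rewrite /a /j; case: (ltP 0 (fine J)) => // _.
  by rewrite expr0n mulr0 ltxx.
have J_neq0 : J != 0%E.
  by apply/negP => /eqP J0; move: a_gt0; rewrite /a jE J0 expr0n mulr0 ltxx.
rewrite (negbTE J_neq0) -jE lee_fin.
have c_gt0 : 0 < v `^ (1 / 3) by rewrite powR_gt0.
have sqrt_le : Num.sqrt v <= v `^ (1 / 3) by rewrite root3_ge_sqrt // v_gt0.
have -> : 8 * L%:R ^+ 2 * j ^+ 2 = 8 * a by rewrite /a mulrA.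
rewrite div1r -mulrA -invfM ler_pdivrMr; last by rewrite mulr_gt0 // mulr_gt0.
(* The first entry of the minimum is bounded through [1 - expR (- z) <= z] at [z = gamma / 9]. *)
apply: (@le_trans _ _ (gamma / 9)).
  rewrite ge_min; apply/orP; left.
  by have := expR_ge1Dx (- (gamma / 9)); lra.
have : a * tau * Num.sqrt v <= a * tau * v `^ (1 / 3).
  by rewrite ler_wpM2l // mulr_ge0.
lra.
Qed.
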